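(* Let $(S,\lhd)$ be a self-similar structure of a semi-monoidal category $(\mathcal C,\otimes,\tau_{\_,\_,\_})$, and let $\mathfrak E$ be a diagram over $\mathcal C_S$ canonical for $\{\otimes,\,\tau_{\_,\_,\_},\,\lhd,\,\star,\,\alpha,\,(\ )^{-1}\}$. Then $\mathfrak E$ commutes whenever there exists a diagram $\mathfrak D$ over $\mathcal F_S$, canonical for $\{\Box,\,t_{\_,\_,\_},\,\lhd_{\_},\,\star,\,\alpha,\,(\ )^{-1}\}$, satisfying: 1. the equivalence class of $\mathfrak D$ under self-similarity equivalence contains a diagram canonical for $\{\Box,\,t_{\_,\_,\_},\,(\ )^{-1}\}$ (equivalently, $\Phi(\mathfrak D)$ is guaranteed to commute by MacLane's coherence theorem for associativity, applied to $(End(x),\star,\alpha)$); 2. $Inst(\mathfrak D)=\mathfrak E$.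
   Context: A semi-monoidal category is a category $\mathcal C$ with a functor $\otimes:\mathcal C\times\mathcal C\to\mathcal C$ and natural isomorphisms $\tau_{X,Y,Z}:X\otimes(Y\otimes Z)\to(X\otimes Y)\otimes Z$ satisfying MacLane's pentagon condition; no unit object is assumed. Standing convention: every object $A$ of a semi-monoidal category is faithful, i.e. the functors $A\otimes\_$ and $\_\otimes A$ are faithful. A self-similar structure $(S,\lhd)$ of $\mathcal C$ consists of an object $S$ and an isomorphism $\lhd:S\otimes S\to S$, with inverse $\rhd=\lhd^{-1}$. Composition is written right to left. $\mathrm{Tree}$ is the set of non-empty binary trees over a symbol $x$: $x\in\mathrm{Tree}$, and $(u\Box v)\in\mathrm{Tree}$ for all $u,v\in\mathrm{Tree}$. Define $Inst(x)=S$, $Inst(p\Box q)=Inst(p)\otimes Inst(q)$. The semi-monoidal category $(\mathcal F_S,\Box,t)$ freely generated by $S$ has $Ob(\mathcal F_S)=\mathrm{Tree}$, $\mathcal F_S(u,v)=\mathcal C(Inst(u),Inst(v))$, composition inherited from $\mathcal C$, tensor $u\Box v$ on objects and $f\Box g=f\otimes g$ on arrows, and $t_{u,v,w}=\tau_{Inst(u),Inst(v),Inst(w)}$. $\mathcal C_S$ is the full semi-monoidal subcategory of $\mathcal C$ on the objects $Inst(u)$, $u\in\mathrm{Tree}$, and $Inst:\mathcal F_S\to\mathcal C_S$ is the strict semi-monoidal functor given by $Inst$ on objects and the identity on hom-sets. The generalised code isomorphisms $\lhd_u\in\mathcal F_S(u,x)$ are given by $\lhd_x=1_S$, $\lhd_{x\Box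 x}=\lhd$, $\lhd_{u\Box v}=\lhd_{x\Box x}(\lhd_u\Box\lhd_v)$, with inverses $\rhd_u\in\mathcal F_S(x,u)$. $End(x)$ is the monoid $\mathcal F_S(x,x)=\mathcal C(S,S)$ as a one-object category; $\Phi:\mathcal F_S\to End(x)$ is the functor sending every object to $x$ and $f\in\mathcal F_S(a,b)$ to $\lhd_b f\rhd_a$. The operation $f\star g=\Phi(f\Box g)$ is a semi-monoidal tensor on $End(x)$ with associativity isomorphism $\alpha=\Phi(t_{x,x,x})$; $\star$ and $\alpha$ are also regarded as an operation on, and an element of, $\mathcal F_S(x,x)=\mathcal C(S,S)$. A diagram over a small category $\mathcal A$ is a directed graph $G$ with a compatible assignment of objects of $\mathcal A$ to vertices and arrows of $\mathcal A$ to edges; its image under a functor has the same underlying graph. A diagram is canonical for a class $\Gamma$ of operations and arrows when its edges are built inductively (from identities, by composition and the operations) from members of $\Gamma$. Diagrams $\mathfrak T,\mathfrak U$ over $\mathcal F_S$ with graphs $G,G'$ are self-similarity equivalent when there is a graph isomorphism $\eta:G\to G'$ such that for every edge $e:s\to t$ of $G$, $\mathfrak T(e)\,\rhd_{\mathfrak T(s)}\lhd_{\mathfrak U(\eta(s))}=\rhd_{\mathfrak T(t)}\lhd_{\mathfrak U(\eta(t))}\,\mathfrak U(\eta(e))$; this is an equivalence relation. Let $(\mathcal W,\Box)$ be the category with $Ob(\mathcal W)=\mathrm{Tree}$, a unique arrow $u\to v$ when $u$ and $v$ have the same number of leaves and none otherwise, and tensor $u\Box v$. MacLane's substitution functor $\mathcal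 W\mathrm{Sub}:(\mathcal W,\Box)\to(End(x),\star)$ is the strict semi-monoidal functor sending every object to $x$ and every arrow $a\Box(b\Box c)\to(a\Box b)\Box c$ to $\alpha$. A diagram over $End(x)$ is ''guaranteed to commute by MacLane's coherence theorem for associativity'' when it is of the form $\mathcal W\mathrm{Sub}(\mathfrak P)$ for some diagram $\mathfrak P$ over $\mathcal W$. *)

(* Defs.v *)
From Corelib Require Import ssreflect ssrfun.
From Stdlib Require Import Eqdep_dec PeanoNat.

Set Implicit Arguments.
Unset Strict Implicit.
Unset Printing Implicit Defensive.

Declare Scope smcat_scope.
Delimit Scope smcat_scope with smcat.
Local Open Scope smcat_scope.

Record category := Category {
  ob :> Type;
  hom : ob -> ob -> Type;
  idn : forall a, hom a a;
  comp : forall a b c, hom b c -> hom a b -> hom a c;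
  comp_idl : forall a b (f : hom a b), comp (idn b) f = f;
  comp_idr : forall a b (f : hom a b), comp f (idn a) = f;
  comp_assoc : forall a b c d (h : hom c d) (g : hom b c) (f : hom a b),
    comp h (comp g f) = comp (comp h g) f
}.

Arguments hom {_} _ _.
Arguments idn {_} a.
Arguments comp {_ _ _ _} _ _.

Notation "g ∘ f" := (comp g f)
  (at level 40, left associativity) : smcat_scope.

Lemma comp_cancel (A : category) (a b c d : A) (h : hom b d) (g : hom c b)
    (f : hom b c) (k : hom a b) : g ∘ f = idn b -> (h ∘ g) ∘ (f ∘ k) = h ∘ k.
Proof. by move=> gf; rewrite -comp_assoc (comp_assoc g) gf comp_idl. Qed.

Definition mutually_inverse (A : category) (a b : A)
    (f : hom a b) (g : hom b a) : Prop :=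
  g ∘ f = idn a /\ f ∘ g = idn b.

Record functor (A B : category) := Functor {
  fob :> A -> B;
  fhom : forall a b, hom a b -> hom (fob a) (fob b);
  fhom_id : forall a, fhom (idn a) = idn (fob a);
  fhom_comp : forall a b c (g : hom b c) (f : hom a b),
    fhom (g ∘ f) = fhom g ∘ fhom f
}.

Arguments fhom {A B} _ {a b} _.

(* The last two axioms are the standing convention that every object [a] is
   faithful, i.e. that the functors [a ⊗ _] and [_ ⊗ a] are faithful. *)
Record semi_monoidal := SemiMonoidal {
  smcat :> category;
  tensor : smcat -> smcat -> smcat;
  tensor_hom : forall a a' b b' : smcat,
    hom a a' -> hom b b' -> hom (tensor a b) (tensor a' b');
  tau : forall a b c : smcat,
    hom (tensor a (tensor b c)) (tensor (tensor a b) c);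
  tau_inv : forall a b c : smcat,
    hom (tensor (tensor a b) c) (tensor a (tensor b c));
  tensor_id : forall a b : smcat,
    tensor_hom (idn a) (idn b) = idn (tensor a b);
  tensor_comp : forall (a a' a'' b b' b'' : smcat)
      (f' : hom a' a'') (f : hom a a') (g' : hom b' b'') (g : hom b b'),
    tensor_hom (f' ∘ f) (g' ∘ g) = tensor_hom f' g' ∘ tensor_hom f g;
  tau_iso : forall a b c : smcat,
    mutually_inverse (tau a b c) (tau_inv a b c);
  tau_natural : forall (a a' b b' c c' : smcat)
      (f : hom a a') (g : hom b b') (h : hom c c'),
    tau a' b' c' ∘ tensor_hom f (tensor_hom g h)
    = tensor_hom (tensor_hom f g) h ∘ tau a b c;
  pentagon : forall a b c d : smcat,
    tau (tensor a b) c d ∘ tau a b (tensor c d)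
    = tensor_hom (tau a b c) (idn d) ∘ tau a (tensor b c) d
      ∘ tensor_hom (idn a) (tau b c d);
  faithful_l : forall (a b b' : smcat) (f g : hom b b'),
    tensor_hom (idn a) f = tensor_hom (idn a) g -> f = g;
  faithful_r : forall (a b b' : smcat) (f g : hom b b'),
    tensor_hom f (idn a) = tensor_hom g (idn a) -> f = g
}.

Arguments tensor {s} _ _.
Arguments tensor_hom {s a a' b b'} _ _.
Arguments tau {s} a b c.
Arguments tau_inv {s} a b c.

Notation "a ⊗ b" := (tensor a b)
  (at level 35, right associativity) : smcat_scope.
Notation "f ⊗₁ g" := (tensor_hom f g)
  (at level 35, right associativity) : smcat_scope.

(* Equality of arrows whose endpoints need not be convertible; it forces the
   endpoints to be equal. *)
Inductive arrow_eq (A : category) (a b : A) (f : hom a b) :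
    forall c d : A, hom c d -> Prop :=
  arrow_eq_refl : arrow_eq f f.

Definition strict_semi_monoidal (M N : semi_monoidal) (F : functor M N) : Prop :=
  (forall a b : M, F (a ⊗ b) = F a ⊗ F b) /\
  (forall (a a' b b' : M) (f : hom a a') (g : hom b b'),
     arrow_eq (fhom F (f ⊗₁ g)) (fhom F f ⊗₁ fhom F g)) /\
  (forall a b c : M, arrow_eq (fhom F (tau a b c)) (tau (F a) (F b) (F c))).

Record self_similar (M : semi_monoidal) := SelfSimilar {
  ss_ob :> M;
  ss_code : hom (ss_ob ⊗ ss_ob) ss_ob;
  ss_decode : hom ss_ob (ss_ob ⊗ ss_ob);
  ss_iso : mutually_inverse ss_code ss_decode
}.

Record graph := Graph {
  vertex :> Type;
  edge : vertex -> vertex -> Type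
}.

Arguments edge {g} _ _.

Record graph_iso (G G' : graph) := GraphIso {
  vmap :> G -> G';
  emap : forall s t : G, edge s t -> edge (vmap s) (vmap t);
  vmap_bij : bijective vmap;
  emap_bij : forall s t : G, bijective (@emap s t)
}.

Arguments emap {G G'} _ {s t} _.

Record diagram (G : graph) (A : category) := Diagram {
  dob :> G -> A;
  dhom : forall s t : G, edge s t -> hom (dob s) (dob t)
}.

Arguments dhom {G A} _ {s t} _.

Definition diagram_image (G : graph) (A B : category) (F : functor A B)
    (D : diagram G A) : diagram G B :=
  {| dob := fun v => F (D v);
     dhom := fun s t (e : edge s t) => fhom F (dhom D e) |}.

Inductive path (G : graph) (s : G) : G -> Type :=
| path_nil : path s s
| path_snoc : forall t u : G, path s t -> edge t u -> path s u.

Arguments path {G} s _.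

Fixpoint path_comp (G : graph) (A : category) (D : diagram G A) (s t : G)
    (p : path s t) : hom (D s) (D t) :=
  match p with
  | path_nil _ => idn (D s)
  | path_snoc q e => dhom D e ∘ path_comp D q
  end.

Definition commutes (G : graph) (A : category) (D : diagram G A) : Prop :=
  forall (s t : G) (p q : path s t), path_comp D p = path_comp D q.

(* A class [Γ] of arrows and (binary) operations on arrows. *)
Record signature (A : category) := Signature {
  sig_arrow : forall a b : A, hom a b -> Prop;
  sig_op : forall a a' b b' c c' : A,
    (hom a a' -> hom b b' -> hom c c') -> Prop
}.

Arguments sig_arrow {A} _ {a b} _.
Arguments sig_op {A} _ {a a' b b' c c'} _.

(* The partial unary operation ( )^{-1} belongs to every class considered
   below, so it is built in. *)
Inductive canonical_arrow (A : category) (Γ : signature A) :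
    forall a b : A, hom a b -> Prop :=
| canonical_id : forall a, canonical_arrow Γ (idn a)
| canonical_comp : forall a b c (g : hom b c) (f : hom a b),
    canonical_arrow Γ g -> canonical_arrow Γ f -> canonical_arrow Γ (g ∘ f)
| canonical_gen : forall a b (f : hom a b),
    sig_arrow Γ f -> canonical_arrow Γ f
| canonical_op : forall a a' b b' c c'
      (o : hom a a' -> hom b b' -> hom c c') (f : hom a a') (g : hom b b'),
    sig_op Γ o -> canonical_arrow Γ f -> canonical_arrow Γ g ->
    canonical_arrow Γ (o f g)
| canonical_inv : forall a b (f : hom a b) (g : hom b a),
    mutually_inverse f g -> canonical_arrow Γ f -> canonical_arrow Γ g.

Definition canonical (G : graph) (A : category) (Γ : signature A)
    (D : diagram G A) : Prop :=
  forall (s t : G) (e : edge s t), canonical_arrow Γ (dhom D e).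

Inductive tau_arrow (M : semi_monoidal) : forall a b : M, hom a b -> Prop :=
  is_tau : forall a b c : M, tau_arrow (tau a b c).

Inductive tensor_op (M : semi_monoidal) : forall a a' b b' c c' : M,
    (hom a a' -> hom b b' -> hom c c') -> Prop :=
  is_tensor : forall a a' b b' : M, tensor_op (@tensor_hom M a a' b b').

Definition assoc_signature (M : semi_monoidal) : signature M :=
  {| sig_arrow := @tau_arrow M; sig_op := @tensor_op M |}.

Inductive tree := leaf | node (u v : tree).

Fixpoint leaves (u : tree) : nat :=
  match u with
  | leaf => 1
  | node v w => leaves v + leaves w
  end.

Lemma W_unique (u v : tree) (f g : leaves u = leaves v) : f = g.
Proof. exact: (UIP_dec Nat.eq_dec). Qed.

Definition W_cat : category := {|
  ob := tree;
  hom := fun u v => leaves u = leaves v;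
  idn := fun u => eq_refl;
  comp := fun u v w g f => eq_trans f g;
  comp_idl := fun u v f => W_unique _ _;
  comp_idr := fun u v f => W_unique _ _;
  comp_assoc := fun u v w z h g f => W_unique _ _
|}.

Definition W : semi_monoidal.
Proof.
refine {|
  smcat := W_cat;
  tensor := (node : W_cat -> W_cat -> W_cat);
  tensor_hom := fun u u' v v' (f : leaves u = leaves u')
    (g : leaves v = leaves v') => f_equal2 Nat.add f g;
  tau := fun u v w => Nat.add_assoc (leaves u) (leaves v) (leaves w);
  tau_inv := fun u v w => eq_sym (Nat.add_assoc (leaves u) (leaves v) (leaves w))
|}; try by move=> *; exact: W_unique.
by move=> *; split; exact: W_unique.
Defined.

Section SelfSimilarity.

Variables (M : semi_monoidal) (S : self_similar M).

Fixpoint inst (u : tree) : M :=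
  match u with
  | leaf => S
  | node v w => inst v ⊗ inst w
  end.

Definition FS_cat : category := {|
  ob := tree;
  hom := fun u v => hom (inst u) (inst v);
  idn := fun u => idn (inst u);
  comp := fun u v w (g : hom (inst v) (inst w)) (f : hom (inst u) (inst v)) =>
    g ∘ f;
  comp_idl := fun u v => @comp_idl M (inst u) (inst v);
  comp_idr := fun u v => @comp_idr M (inst u) (inst v);
  comp_assoc := fun u v w z => @comp_assoc M (inst u) (inst v) (inst w) (inst z)
|}.

Definition FS : semi_monoidal := {|
  smcat := FS_cat;
  tensor := (node : FS_cat -> FS_cat -> FS_cat);
  tensor_hom := fun u u' v v' (f : hom (inst u) (inst u'))
    (g : hom (inst v) (inst v')) => f ⊗₁ g;
  tau := fun u v w => tau (inst u) (inst v) (inst w);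
  tau_inv := fun u v w => tau_inv (inst u) (inst v) (inst w);
  tensor_id := fun u v => tensor_id (inst u) (inst v);
  tensor_comp := fun u u' u'' v v' v'' =>
    @tensor_comp M (inst u) (inst u') (inst u'') (inst v) (inst v') (inst v'');
  tau_iso := fun u v w => tau_iso (inst u) (inst v) (inst w);
  tau_natural := fun u u' v v' w w' =>
    @tau_natural M (inst u) (inst u') (inst v) (inst v') (inst w) (inst w');
  pentagon := fun u v w z => pentagon (inst u) (inst v) (inst w) (inst z);
  faithful_l := fun u v w => @faithful_l M (inst u) (inst v) (inst w);
  faithful_r := fun u v w => @faithful_r M (inst u) (inst v) (inst w)
|}.

(* ◁_u and ▷_u.  The clause ◁_{x □ x} = ◁ of the definition is [code_xx]. *)
Fixpoint code (u : tree) : hom (u : FS) (leaf : FS) :=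
  match u with
  | leaf => idn S
  | node v w => (ss_code S : hom (node leaf leaf : FS) (leaf : FS))
                ∘ (code v ⊗₁ code w)
  end.

Fixpoint decode (u : tree) : hom (leaf : FS) (u : FS) :=
  match u with
  | leaf => idn S
  | node v w => (decode v ⊗₁ decode w)
                ∘ (ss_decode S : hom (leaf : FS) (node leaf leaf : FS))
  end.

Lemma code_xx : code (node leaf leaf) = ss_code S.
Proof. by rewrite /= tensor_id comp_idr. Qed.

Lemma code_decode (u : tree) : mutually_inverse (code u) (decode u).
Proof.
elim: u => [|v [v1 v2] w [w1 w2]].
  by split; exact: comp_idl.
have [s1 s2] := ss_iso S.
rewrite /= in v1 v2 w1 w2; split=> /=.
- by rewrite (comp_cancel _ _ s1) -tensor_comp v1 w1; exact: tensor_id.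
- rewrite (comp_cancel (A := M)) //.
  by rewrite -tensor_comp v2 w2; exact: tensor_id.
Qed.

Definition End_cat : category := {|
  ob := unit;
  hom := fun _ _ => hom (leaf : FS) (leaf : FS);
  idn := fun _ => idn (leaf : FS);
  comp := fun _ _ _ g f => g ∘ f;
  comp_idl := fun _ _ f => comp_idl f;
  comp_idr := fun _ _ f => comp_idr f;
  comp_assoc := fun _ _ _ _ h g f => comp_assoc h g f
|}.

Definition phi_hom (u v : FS) (f : hom u v) : hom (leaf : FS) (leaf : FS) :=
  code v ∘ f ∘ decode u.

Lemma phi_id (u : FS) : phi_hom (idn u) = idn (leaf : FS).
Proof. by rewrite /phi_hom comp_idr; case: (code_decode u). Qed.

Lemma phi_comp (u v w : FS) (g : hom v w) (f : hom u v) :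
  phi_hom (g ∘ f) = phi_hom g ∘ phi_hom f.
Proof.
rewrite /phi_hom -!comp_assoc (comp_assoc (decode v)).
by have [-> _] := code_decode v; rewrite comp_idl.
Qed.

Definition Phi : functor FS End_cat := {|
  fob := (fun _ => tt) : FS -> End_cat;
  fhom := phi_hom;
  fhom_id := phi_id;
  fhom_comp := phi_comp
|}.

Definition star (f g : hom (leaf : FS) (leaf : FS)) : hom (leaf : FS) (leaf : FS) :=
  phi_hom (f ⊗₁ g).

Definition alpha : hom (leaf : FS) (leaf : FS) :=
  phi_hom (tau (leaf : FS) leaf leaf).

Definition alpha_inv : hom (leaf : FS) (leaf : FS) :=
  phi_hom (tau_inv (leaf : FS) leaf leaf).

Lemma phi_inj (u v : FS) (f g : hom u v) : phi_hom f = phi_hom g -> f = g.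
Proof.
have [u1 u2] := code_decode u; have [v1 v2] := code_decode v.
have K (h : hom u v) : decode v ∘ phi_hom h ∘ code u = h.
  by rewrite /phi_hom !comp_assoc v1 comp_idl -comp_assoc u1 comp_idr.
by move=> e; rewrite -(K f) e K.
Qed.

Lemma phi_tensor (u u' v v' : FS) (f : hom u u') (g : hom v v') :
  phi_hom (f ⊗₁ g) = star (phi_hom f) (phi_hom g).
Proof.
rewrite /star /phi_hom /=.
by rewrite !tensor_id !comp_idr comp_idl !tensor_comp !comp_assoc.
Qed.

Lemma phi_tau (u v w : FS) : phi_hom (tau u v w) = alpha.
Proof.
have nat : tau (leaf : FS) leaf leaf ∘ (code u ⊗₁ (code v ⊗₁ code w))
    = ((code u ⊗₁ code v) ⊗₁ code w) ∘ tau u v w.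
  exact: tau_natural.
have [u1 u2] := code_decode u; have [v1 v2] := code_decode v.
have [w1 w2] := code_decode w.
have {}nat : tau u v w
    = ((decode u ⊗₁ decode v) ⊗₁ decode w) ∘ tau (leaf : FS) leaf leaf
      ∘ (code u ⊗₁ (code v ⊗₁ code w)).
  rewrite -comp_assoc nat comp_assoc -!tensor_comp u1 v1 w1 !tensor_id.
  by rewrite comp_idl.
have hom_id (f : hom (leaf : FS) (leaf : FS)) :
    f = idn (leaf : FS) -> f = phi_hom (idn (leaf : FS)).
  by move=> ->; rewrite phi_id.
have phi_code (a : FS) : phi_hom (code a) = idn (leaf : FS).
  by rewrite /phi_hom /= comp_idl; case: (code_decode a).
have phi_decode (a : FS) : phi_hom (decode a) = idn (leaf : FS).
  by rewrite /phi_hom /= comp_idr; case: (code_decode a).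
have star_id : star (idn _) (idn _) = idn (leaf : FS).
  by rewrite /star tensor_id phi_id.
rewrite nat !phi_comp !phi_tensor !phi_code !phi_decode !star_id.
by rewrite comp_idl comp_idr.
Qed.

Lemma star_comp (f' f g' g : hom (leaf : FS) (leaf : FS)) :
  star (f' ∘ f) (g' ∘ g) = star f' g' ∘ star f g.
Proof. by rewrite /star tensor_comp phi_comp. Qed.

Lemma phi_endo (f : hom (leaf : FS) (leaf : FS)) : phi_hom f = f.
Proof. by rewrite /phi_hom comp_idl comp_idr. Qed.

Lemma star_idl (f : hom (leaf : FS) (leaf : FS)) (u : FS) :
  star (idn _) f = phi_hom (idn u ⊗₁ f).
Proof. by rewrite phi_tensor phi_id phi_endo. Qed.

Lemma star_idr (f : hom (leaf : FS) (leaf : FS)) (u : FS) :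
  star f (idn _) = phi_hom (f ⊗₁ idn u).
Proof. by rewrite phi_tensor phi_id phi_endo. Qed.

Definition EndX : semi_monoidal.
Proof.
refine {|
  smcat := End_cat;
  tensor := fun _ _ => tt : End_cat;
  tensor_hom := fun _ _ _ _ => star;
  tau := fun _ _ _ => alpha;
  tau_inv := fun _ _ _ => alpha_inv
|} => /=.
- by move=> _ _; rewrite /star tensor_id phi_id.
- by move=> *; exact: star_comp.
- move=> _ _ _; have [t1 t2] := tau_iso (leaf : FS) leaf leaf.
  split; rewrite /= /alpha /alpha_inv.
    exact: (etrans (esym (phi_comp _ _)) (etrans (congr1 _ t1) (phi_id _))).
  exact: (etrans (esym (phi_comp _ _)) (etrans (congr1 _ t2) (phi_id _))).
- move=> _ _ _ _ _ _.
  change (forall f g h : hom (leaf : FS) (leaf : FS),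
    alpha ∘ star f (star g h) = star (star f g) h ∘ alpha) => f g h.
  have := congr1 (@phi_hom _ _) (@tau_natural FS _ _ _ _ _ _ f g h).
  by rewrite !phi_comp !phi_tensor !phi_tau !phi_endo.
- move=> _ _ _ _.
  have := congr1 (@phi_hom _ _) (@pentagon FS leaf leaf leaf leaf).
  by rewrite !phi_comp !phi_tensor !phi_tau !phi_id.
- by move=> _ _ _ f g; rewrite /star => /phi_inj /faithful_l.
- by move=> _ _ _ f g; rewrite /star => /phi_inj /faithful_r.
Defined.

Definition CS_ob : Type := {a : M | exists u, inst u = a}.

(* Transparent, so that [inst_ob (node u v)] is convertible to
   [CS_tensor (inst_ob u) (inst_ob v)]. *)
Definition CS_tensor (a b : CS_ob) : CS_ob :=
  exist _ (proj1_sig a ⊗ proj1_sig b)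
    match proj2_sig a, proj2_sig b with
    | ex_intro _ u hu, ex_intro _ v hv =>
        ex_intro _ (node u v)
          match hu in _ = a', hv in _ = b'
            return inst u ⊗ inst v = a' ⊗ b' with
          | eq_refl, eq_refl => eq_refl
          end
    end.

Definition CS_cat : category := {|
  ob := CS_ob;
  hom := fun a b => hom (proj1_sig a) (proj1_sig b);
  idn := fun a => idn (proj1_sig a);
  comp := fun a b c (g : hom (proj1_sig b) (proj1_sig c))
    (f : hom (proj1_sig a) (proj1_sig b)) => g ∘ f;
  comp_idl := fun a b f => comp_idl f;
  comp_idr := fun a b f => comp_idr f;
  comp_assoc := fun a b c d h g f => comp_assoc h g f
|}.

Definition CS : semi_monoidal.
Proof.
refine {|
  smcat := CS_cat;
  tensor := CS_tensor : CS_cat -> CS_cat -> CS_cat;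
  tensor_hom := fun (a a' b b' : CS_cat)
    (f : hom (proj1_sig a) (proj1_sig a'))
    (g : hom (proj1_sig b) (proj1_sig b')) => f ⊗₁ g;
  tau := fun a b c => tau (proj1_sig a) (proj1_sig b) (proj1_sig c);
  tau_inv := fun a b c => tau_inv (proj1_sig a) (proj1_sig b) (proj1_sig c)
|} => /= *.
- exact: tensor_id.
- exact: tensor_comp.
- exact: tau_iso.
- exact: tau_natural.
- exact: pentagon.
- by apply: faithful_l; eassumption.
- by apply: faithful_r; eassumption.
Defined.

Definition inst_ob (u : tree) : CS := exist _ (inst u) (ex_intro _ u eq_refl).

Definition Inst : functor FS CS := {|
  fob := inst_ob : FS -> CS;
  fhom := fun u v (f : hom (inst u) (inst v)) => f;
  fhom_id := fun u => eq_refl;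
  fhom_comp := fun u v w g f => eq_refl
|}.

Lemma Inst_strict : strict_semi_monoidal Inst.
Proof.
split; first by move=> u v; reflexivity.
split=> [u u' v v' f g|u v w].
- exact: (@arrow_eq_refl CS (inst_ob (node u v)) (inst_ob (node u' v'))).
- exact: (@arrow_eq_refl CS (inst_ob (node u (node v w)))
    (inst_ob (node (node u v) w))).
Qed.

Lemma Phi_strict : strict_semi_monoidal (Phi : functor FS EndX).
Proof.
split=> //; split=> /=.
- by move=> u u' v v' f g; rewrite phi_tensor; exact: (@arrow_eq_refl EndX tt tt).
- by move=> u v w; rewrite phi_tau; exact: (@arrow_eq_refl EndX tt tt).
Qed.

Inductive FS_arrow : forall u v : FS, hom u v -> Prop :=
| FS_t : forall u v w : FS, FS_arrow (tau u v w)
| FS_code : forall u : FS, FS_arrow (code u)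
| FS_alpha : FS_arrow alpha.

Inductive FS_op : forall u u' v v' w w' : FS,
    (hom u u' -> hom v v' -> hom w w') -> Prop :=
| FS_tensor : forall u u' v v' : FS, FS_op (@tensor_hom FS u u' v v')
| FS_star : FS_op star.

Definition FS_signature : signature FS :=
  {| sig_arrow := @FS_arrow; sig_op := @FS_op |}.

Inductive CS_arrow : forall a b : CS, hom a b -> Prop :=
| CS_tau : forall a b c : CS, CS_arrow (tau a b c)
| CS_code :
    CS_arrow (ss_code S : hom (inst_ob leaf ⊗ inst_ob leaf) (inst_ob leaf))
| CS_alpha : CS_arrow (alpha : hom (inst_ob leaf) (inst_ob leaf)).

Inductive CS_op : forall a a' b b' c c' : CS,
    (hom a a' -> hom b b' -> hom c c') -> Prop :=
| CS_tensor_op : forall a a' b b' : CS, CS_op (@tensor_hom CS a a' b b')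
| CS_star :
    CS_op (star : hom (inst_ob leaf) (inst_ob leaf) ->
                  hom (inst_ob leaf) (inst_ob leaf) ->
                  hom (inst_ob leaf) (inst_ob leaf)).

Definition CS_signature : signature CS :=
  {| sig_arrow := @CS_arrow; sig_op := @CS_op |}.

Definition selfsim_equiv (G G' : graph) (T : diagram G FS) (U : diagram G' FS) : Prop :=
  exists eta : graph_iso G G', forall (s t : G) (e : edge s t),
    dhom T e ∘ (decode (T s) ∘ code (U (eta s)))
    = (decode (T t) ∘ code (U (eta t))) ∘ dhom U (emap eta e).

Definition selfsim_assoc_canonical (G : graph) (D : diagram G FS) : Prop :=
  exists (G' : graph) (U : diagram G' FS),
    selfsim_equiv D U /\ canonical (assoc_signature FS) U.

(* Strictness determines such a functor uniquely; its existence is MacLane's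
   coherence theorem for (End(x), ⋆, α).  The clause on arrows restates the
   preservation of associators, [W] having at most one arrow u -> v. *)
Definition is_WSub (F : functor W EndX) : Prop :=
  strict_semi_monoidal F /\
  (forall (a b c : W) (f : hom (a ⊗ (b ⊗ c)) ((a ⊗ b) ⊗ c)), fhom F f = alpha).

Definition guaranteed_by_MacLane (G : graph) (D : diagram G EndX) : Prop :=
  exists WSub : functor W EndX, is_WSub WSub /\
  exists P : diagram G W, D = diagram_image WSub P.

End SelfSimilarity.

(* Main.v *)
Require Import Defs.
From Corelib Require Import ssreflect ssrfun.
From Stdlib Require Import FunctionalExtensionality PeanoNat.

(** Call an arrow of [FS S] associative when it is built from associators
    alone.  The theorem compares three kinds of arrows: the associative ones,
    the arrows of [W], and the endomorphisms of [S].

    An associative arrow [u -> v] preserves the number of leaves, so it lies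
    over the unique arrow [u -> v] of [W] ([assoc_leaves]); conversely every
    arrow of [W] lies under some associative arrow ([assoc_of_leaves]), because
    any two trees with equally many leaves can be rebracketed into the same
    left comb.  A substitution functor sends the arrow of [W] to the image
    under [Phi] of any associative arrow above it: both sides preserve tensor,
    associators, composition and inverses ([WSub_assoc]).  Hence such a functor
    matches diagrams of associative arrows with images of diagrams over [W],
    and self-similarity equivalence of [D] and [U] says exactly that
    [Phi] takes the same values on corresponding edges ([selfsim_phi]).

    What remains is that a substitution functor exists ([rebracket_WSub]): this is
    MacLane's coherence theorem.  Each tree [u] is given an invertible
    endomorphism [flatten u], the image of a rebracketing of [u] into a left
    comb, and the arrow [u -> v] is sent to [unflatten v ∘ flatten u].
    Compatibility with [⋆] holds because flattening [node v w] first flattens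
    [v] and [w] and then applies an endomorphism depending only on the number
    of leaves of [w]; compatibility with [α] is a cocycle identity for these
    endomorphisms, obtained from naturality and the pentagon
    ([merge_cocycle]).

    The commutation of [E] follows: every diagram over [W] commutes, functors
    carry commuting diagrams to commuting diagrams, and [Phi] is faithful. *)

Set Implicit Arguments.
Unset Strict Implicit.
Unset Printing Implicit Defensive.

Local Open Scope smcat_scope.

(** * Diagrams and functors *)

Lemma path_comp_image (G : graph) (A B : category) (F : functor A B)
    (D : diagram G A) (s t : G) (p : path s t) :
  path_comp (diagram_image F D) p = fhom F (path_comp D p).
Proof. by elim: p => [|t' u q /= -> e]; rewrite ?fhom_id ?fhom_comp. Qed.

Lemma commutes_image (G : graph) (A B : category) (F : functor A B)
    (D : diagram G A) : commutes D -> commutes (diagram_image F D).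
Proof. by move=> cD s t p q; rewrite !path_comp_image (cD _ _ p q). Qed.

Lemma commutes_faithful (G : graph) (A B : category) (F : functor A B)
    (D : diagram G A) :
  (forall (a b : A) (f g : hom a b), fhom F f = fhom F g -> f = g) ->
  commutes (diagram_image F D) -> commutes D.
Proof.
move=> Finj cFD s t p q; apply: Finj.
by have := cFD s t p q; rewrite !path_comp_image.
Qed.

Lemma commutes_W (G : graph) (P : diagram G W) : commutes P.
Proof. by move=> s t p q; exact: W_unique. Qed.

Section Coherence.

Variables (M : semi_monoidal) (S : self_similar M).

Notation endo := (hom (leaf : FS S) (leaf : FS S)).

(** * Associative arrows *)

Definition assoc_arrow (u v : FS S) (f : hom u v) : Prop :=
  canonical_arrow (assoc_signature (FS S)) f.

Lemma assoc_leaves (u v : FS S) (f : hom u v) :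
  assoc_arrow f -> leaves u = leaves v.
Proof.
elim=> {u v f} //.
- by move=> a b c g f _ gE _ fE; rewrite fE.
- by move=> a b f [u v w]; exact: Nat.add_assoc.
- move=> a a' b b' c c' o f g op _ fE _ gE.
  by case: op fE gE => u u' v v' /= -> ->.
Qed.

(** Valued in [Type], so that the edges of a diagram can be read off it.
    Asking for arrows in both directions makes the relation symmetric by
    definition; no inverse has to be tracked. *)
Definition linked (u v : FS S) : Type :=
  {f : hom u v | assoc_arrow f} * {g : hom v u | assoc_arrow g}.

Lemma linked_refl u : linked u u.
Proof. by split; exists (idn u); exact: canonical_id. Qed.

Lemma linked_sym u v : linked u v -> linked v u.
Proof. by case. Qed.

Lemma linked_trans v u w : linked u v -> linked v w -> linked u w.
Proof.
move=> [[f cf] [f' cf']] [[g cg] [g' cg']].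
by split; [exists (g ∘ f)|exists (f' ∘ g')]; exact: canonical_comp.
Qed.

Lemma assoc_tensor (u u' v v' : FS S) (f : hom u u') (g : hom v v') :
  assoc_arrow f -> assoc_arrow g -> assoc_arrow (f ⊗₁ g).
Proof. by apply: canonical_op; exact: is_tensor. Qed.

Lemma linked_node u u' v v' :
  linked u u' -> linked v v' -> linked (node u v) (node u' v').
Proof.
move=> [[f cf] [f' cf']] [[g cg] [g' cg']].
split; first by exists (f ⊗₁ g); exact: assoc_tensor.
by exists (f' ⊗₁ g'); exact: assoc_tensor.
Qed.

Lemma linked_assoc u v w : linked (node u (node v w)) (node (node u v) w).
Proof.
have ct : assoc_arrow (tau (u : FS S) v w).
  by apply: canonical_gen; exact: is_tau.
split; first by exists (tau (u : FS S) v w).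
by exists (tau_inv (u : FS S) v w); exact: canonical_inv (tau_iso _ _ _) ct.
Qed.

(** Combs are indexed by internal nodes rather than leaves, because a tree has
    at least one leaf. *)
Fixpoint left_comb (k : nat) : tree :=
  match k with
  | 0 => leaf
  | Datatypes.S k' => node (left_comb k') leaf
  end.

Lemma linked_comb_node a b :
  linked (node (left_comb a) (left_comb b)) (left_comb (Datatypes.S (a + b))).
Proof.
elim: b => [|b IH] /=; first by rewrite Nat.add_0_r; exact: linked_refl.
apply: linked_trans (linked_assoc _ _ _) _.
by rewrite Nat.add_succ_r; apply: linked_node IH (linked_refl _).
Qed.

Fixpoint nodes (u : tree) : nat :=
  match u with
  | leaf => 0
  | node v w => Datatypes.S (nodes v + nodes w)
  end.

Lemma leaves_nodes u : leaves u = Datatypes.S (nodes u).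
Proof. by elim: u => //= v -> w ->; rewrite /= Nat.add_succ_r. Qed.

Lemma nodes_eq u v : leaves u = leaves v -> nodes u = nodes v.
Proof. by rewrite !leaves_nodes => -[]. Qed.

Lemma linked_comb u : linked u (left_comb (nodes u)).
Proof.
elim: u => [|v IHv w IHw]; first exact: linked_refl.
exact: linked_trans (linked_node IHv IHw) (linked_comb_node _ _).
Qed.

(** Rebracket both trees into the same left comb. *)
Lemma assoc_of_leaves (u v : FS S) :
  leaves u = leaves v -> {f : hom u v | assoc_arrow f}.
Proof.
move=> /nodes_eq uv; have uC := linked_comb u; rewrite uv in uC.
by case: (linked_trans uC (linked_sym (linked_comb v))).
Qed.

(** * The coherence theorem for the endomorphisms of [S] *)

Notation "1" := (idn (leaf : FS S)) : smcat_scope.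

Lemma star_id : star 1 1 = 1.
Proof. exact: (@tensor_id (EndX S) tt tt). Qed.

Lemma alpha_iso : mutually_inverse (alpha S) (alpha_inv S).
Proof. exact: (@tau_iso (EndX S) tt tt tt). Qed.

Lemma alpha_natural (f g h : endo) :
  alpha S ∘ star f (star g h) = star (star f g) h ∘ alpha S.
Proof. exact: (@tau_natural (EndX S) tt tt tt tt tt tt f g h). Qed.

Lemma alpha_pentagon :
  alpha S ∘ alpha S = star (alpha S) 1 ∘ alpha S ∘ star 1 (alpha S).
Proof. exact: (@pentagon (EndX S) tt tt tt tt). Qed.

Lemma star_compl (f g : endo) : star (f ∘ g) 1 = star f 1 ∘ star g 1.
Proof. by rewrite -star_comp comp_idl. Qed.

Lemma star_compr (f g : endo) : star 1 (f ∘ g) = star 1 f ∘ star 1 g.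
Proof. by rewrite -star_comp comp_idl. Qed.

(** [merge k] is the image of a rebracketing of
    [node (left_comb a) (left_comb k)] into a left comb.  It does not depend
    on [a], because [Phi] sends all associators to the same [alpha S]. *)
Fixpoint merge (k : nat) : endo :=
  match k with
  | 0 => 1
  | Datatypes.S k' => star (merge k') 1 ∘ alpha S
  end.

Fixpoint unmerge (k : nat) : endo :=
  match k with
  | 0 => 1
  | Datatypes.S k' => alpha_inv S ∘ star (unmerge k') 1
  end.

Lemma mergeS k : merge (Datatypes.S k) = star (merge k) 1 ∘ alpha S.
Proof. by []. Qed.

Lemma unmergeS k : unmerge (Datatypes.S k) = alpha_inv S ∘ star (unmerge k) 1.
Proof. by []. Qed.

Lemma unmergeK k : mutually_inverse (merge k) (unmerge k).
Proof.
have [a1 a2] := alpha_iso.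
elim: k => [|k [IH1 IH2]]; first by split; exact: comp_idl.
rewrite mergeS unmergeS; split; rewrite comp_cancel //.
- by rewrite -star_compl IH1 star_id.
- by rewrite -star_compl IH2 star_id.
Qed.

(** The two ways of flattening three combs into one agree.  By induction on
    the length of the third comb; the inductive step is the pentagon for the
    first two combs, the third one without its last leaf, and that leaf. *)
Lemma merge_cocycle j k :
  merge k ∘ star (merge j) 1 ∘ alpha S
  = merge (Datatypes.S (j + k)) ∘ star 1 (merge k).
Proof.
elim: k => [|k IH].
  by rewrite Nat.add_0_r mergeS star_id comp_idl comp_idr.
have nat_j : alpha S ∘ star (merge j) 1 = star (star (merge j) 1) 1 ∘ alpha S.
  by rewrite -{1}star_id alpha_natural.
rewrite Nat.add_succ_r (mergeS k) (mergeS (Datatypes.S _)) star_compr.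
rewrite comp_assoc -(comp_assoc _ _ (star 1 (star _ _))).
rewrite alpha_natural comp_assoc -star_compl -IH !star_compl.
rewrite -(comp_assoc _ (alpha S)) nat_j.
rewrite (comp_assoc _ _ (alpha S)) -(comp_assoc _ (alpha S) (alpha S)).
by rewrite alpha_pentagon (comp_assoc _ _ (star 1 _)) (comp_assoc _ _ (alpha S)).
Qed.

Fixpoint flatten (u : tree) : endo :=
  match u with
  | leaf => 1
  | node v w => merge (nodes w) ∘ star (flatten v) (flatten w)
  end.

Fixpoint unflatten (u : tree) : endo :=
  match u with
  | leaf => 1
  | node v w => star (unflatten v) (unflatten w) ∘ unmerge (nodes w)
  end.

Lemma flatten_node v w :
  flatten (node v w) = merge (nodes w) ∘ star (flatten v) (flatten w).
Proof. by []. Qed.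

Lemma unflatten_node v w :
  unflatten (node v w) = star (unflatten v) (unflatten w) ∘ unmerge (nodes w).
Proof. by []. Qed.

Lemma unflattenK u : mutually_inverse (flatten u) (unflatten u).
Proof.
elim: u => [|v [v1 v2] w [w1 w2]]; first by split; exact: comp_idl.
rewrite flatten_node unflatten_node; have [m1 m2] := unmergeK (nodes w).
split; rewrite comp_cancel //.
- by rewrite -star_comp v1 w1 star_id.
- by rewrite -star_comp v2 w2 star_id.
Qed.

(** The two flattenings differ by [merge_cocycle] once naturality has moved the
    associator past the flattened subtrees. *)
Lemma flatten_alpha u v w :
  flatten (node (node u v) w) ∘ alpha S = flatten (node u (node v w)).
Proof.
rewrite !flatten_node.
rewrite -{1}(comp_idl (flatten w)) -{2}(comp_idl (flatten u)) !star_comp.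
rewrite (comp_assoc (merge (nodes (node v w)))) -merge_cocycle.
rewrite -(comp_assoc _ (alpha S)) alpha_natural.
by rewrite (comp_assoc _ _ (alpha S)) (comp_assoc (merge (nodes w))).
Qed.

Definition rebracket (u v : W) (_ : hom u v) : endo := unflatten v ∘ flatten u.

Lemma rebracket_id (u : W) : rebracket (idn u) = 1.
Proof. by case: (unflattenK u). Qed.

Lemma rebracket_comp (u v w : W) (g : hom v w) (f : hom u v) :
  rebracket (g ∘ f) = rebracket g ∘ rebracket f.
Proof. by rewrite /rebracket comp_cancel //; case: (unflattenK v). Qed.

(** The outer [merge] of a flattened [node v w] depends on [w] only through its
    number of leaves, which arrows of [W] preserve, so it cancels. *)
Lemma rebracket_node (u u' v v' : W) (f : hom u u') (g : hom v v') :
  rebracket (f ⊗₁ g) = star (rebracket f) (rebracket g).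
Proof.
rewrite /rebracket flatten_node unflatten_node (nodes_eq g).
have [m _] := unmergeK (nodes v').
by rewrite (comp_cancel _ _ m) star_comp.
Qed.

Lemma rebracket_assoc (u v w : W) (f : hom (u ⊗ (v ⊗ w)) ((u ⊗ v) ⊗ w)) :
  rebracket f = alpha S.
Proof.
have [K _] := unflattenK (node (node u v) w).
by rewrite /rebracket -flatten_alpha comp_assoc K comp_idl.
Qed.

Definition rebracket_functor : functor W (EndX S) := {|
  fob := (fun _ => tt) : W -> EndX S;
  fhom := rebracket;
  fhom_id := rebracket_id;
  fhom_comp := rebracket_comp
|}.

Lemma rebracket_WSub : is_WSub rebracket_functor.
Proof.
split; last exact: rebracket_assoc.
split=> //; split=> [u u' v v' f g|u v w].
- rewrite [fhom _ _]rebracket_node.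
  exact: (@arrow_eq_refl (EndX S) tt tt).
- rewrite [fhom _ _]rebracket_assoc.
  exact: (@arrow_eq_refl (EndX S) tt tt).
Qed.

(** * Substitution functors and associative arrows *)

(** All hom-sets of [EndX S] are one and the same type, so there an equality
    of arrows carries no constraint from their endpoints. *)
Lemma arrow_eq_endo (a b c d : EndX S) (f : hom a b) (g : hom c d) :
  arrow_eq f g -> (f : endo) = g.
Proof. by case. Qed.

(** The value of a substitution functor is forced: trees are formal, so the
    way in which [f] is built from associators can be copied in [W], and both
    the functor and [Phi] respect each step. *)
Lemma WSub_assoc (F : functor W (EndX S)) (u v : FS S) (f : hom u v)
    (p : hom (u : W) v) :
  is_WSub F -> assoc_arrow f -> (fhom F p : endo) = phi_hom f.
Proof.
move=> [[_ [Ften _]] Ftau] cf; elim: cf p => {u v f}.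
- by move=> u p; rewrite phi_id (W_unique p (idn (u : W))) fhom_id.
- move=> u v w g f cg gE cf fE p.
  rewrite phi_comp -(gE (assoc_leaves cg)) -(fE (assoc_leaves cf)).
  rewrite (W_unique p ((assoc_leaves cg : hom (v : W) w) ∘ assoc_leaves cf)).
  exact: (fhom_comp F (assoc_leaves cg : hom (v : W) w) (assoc_leaves cf)).
- by move=> u v f [a b c] p; rewrite phi_tau; exact: Ftau.
- move=> a a' b b' c c' o f g op cf fE cg gE.
  have := assoc_leaves cf; have := assoc_leaves cg.
  case: op f g cf cg fE gE => u u' v v' f g _ _ fE gE q p pq.
  rewrite phi_tensor -(fE p) -(gE q).
  rewrite (W_unique pq ((p : hom (u : W) u') ⊗₁ (q : hom (v : W) v'))).
  exact: arrow_eq_endo (Ften _ _ _ _ _ _).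
- move=> u v f g [gf fg] cf fE q; have p := assoc_leaves cf.
  (* Both values invert [phi_hom f]; a left inverse of it is enough. *)
  have qp : (fhom F q : endo) ∘ phi_hom f = 1.
    rewrite -(fE p); apply: etrans (esym (fhom_comp F q p)) _.
    by rewrite (W_unique (q ∘ p) (idn (u : W))) fhom_id.
  rewrite -[LHS](@comp_idr (FS S)) -(phi_id (v : FS S)) -fg phi_comp.
  by rewrite comp_assoc qp comp_idl.
Qed.

(** * Self-similarity equivalence *)

(** Conjugating by the code isomorphisms turns the square that defines
    self-similarity equivalence into an equality of values of [Phi]. *)
Lemma selfsim_phi (a b c d : FS S) (f : hom a b) (g : hom c d) :
  f ∘ (decode S a ∘ code S c) = (decode S b ∘ code S d) ∘ g
  <-> phi_hom f = phi_hom g.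
Proof.
have [a1 a2] := code_decode S a; have [b1 b2] := code_decode S b.
have [c1 c2] := code_decode S c; have [d1 d2] := code_decode S d.
rewrite /phi_hom; split=> fg.
- have := congr1 (fun h => code S b ∘ h ∘ decode S c) fg.
  by rewrite -!comp_assoc c2 comp_idr !comp_assoc b2 comp_idl.
- have := congr1 (fun h => decode S b ∘ h ∘ code S c) fg.
  by rewrite -!comp_assoc c1 comp_idr !comp_assoc b1 comp_idl.
Qed.

Lemma id_bijective (T : Type) : bijective (fun x : T => x).
Proof. by exists (fun x => x). Qed.

Definition graph_iso_id (G : graph) : graph_iso G G :=
  {| emap := fun s t (e : edge s t) => e;
     vmap_bij := id_bijective G;
     emap_bij := fun s t => id_bijective (edge s t) |}.

Lemma selfsim_MacLane (G : graph) (D : diagram G (FS S)) :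
  selfsim_assoc_canonical D <-> guaranteed_by_MacLane (diagram_image (Phi S) D).
Proof.
split=> [[G' [U [[eta DU] cU]]]|[F [Fsub [P DP]]]].
- exists rebracket_functor; split; first exact: rebracket_WSub.
  pose p (s t : G) (e : edge s t) : hom (U (eta s) : W) (U (eta t)) :=
    assoc_leaves (cU _ _ (emap eta e)).
  exists {| dob := fun s => U (eta s) : W; dhom := p |}.
  have phiD : (fun (s t : G) (e : edge s t) => phi_hom (dhom D e) : endo)
      = fun s t e => rebracket (p s t e).
    apply: functional_extensionality_dep => s.
    apply: functional_extensionality_dep => t.
    apply: functional_extensionality_dep => e.
    have cUe : assoc_arrow (dhom U (emap eta e)) by exact: cU.
    apply: etrans (esym (WSub_assoc (p s t e) rebracket_WSub cUe)).
    by apply/selfsim_phi; exact: DU.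
  exact: (congr1 (fun h : forall s t : G, edge s t -> endo =>
    @Diagram G (EndX S) (fun _ => tt) h) phiD).
- have phiD (s t : G) (e : edge s t) :
      phi_hom (dhom D e) = (fhom F (dhom P e) : endo).
    exact: (congr1 (fun D' : diagram G (EndX S) => (dhom D' e : endo)) DP).
  exists G, {| dob := fun s => P s : FS S;
               dhom := fun s t e => proj1_sig (assoc_of_leaves (dhom P e)) |}.
  split; last by move=> s t e /=; exact: proj2_sig.
  exists (graph_iso_id G) => s t e /=; apply/selfsim_phi.
  rewrite phiD; apply: (WSub_assoc _ Fsub); exact: proj2_sig.
Qed.

End Coherence.

Theorem corollary8p6 (M : semi_monoidal) (S : self_similar M)
    (G : graph) (E : diagram G (CS S))
    (hE : canonical (CS_signature S) E) :
  (forall D : diagram G (FS S), canonical (FS_signature S) D ->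
     (selfsim_assoc_canonical D
      <-> guaranteed_by_MacLane (diagram_image (Phi S) D)))
  /\
  ((exists D : diagram G (FS S),
      canonical (FS_signature S) D /\
      selfsim_assoc_canonical D /\
      diagram_image (Inst S) D = E) ->
   commutes E).
Proof.
split=> [D _|[D [_ [/selfsim_MacLane [F [_ [P DP]]] <-]]]].
  exact: selfsim_MacLane.
apply: commutes_image; apply: (commutes_faithful (F := Phi S)) => [u v f g|].
  exact: phi_inj.
rewrite DP; apply: commutes_image; exact: commutes_W.
Qed.
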